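(* Let $P\in\mathcal{P}(\mathcal{H})$ and let $J\in\mathcal{B}(\mathcal{H})$ be a symmetry with $JP=PJ$. (i) There exists an idempotent $Q\in\mathcal{B}(\mathcal{H})^{Id}\setminus\mathcal{P}(\mathcal{H})$ such that $Q^{or}=P$ and $JQ=Q^{*}J$ if and only if $\dim R(P)\geq 2$ and both $(I+J)P\neq 0$ and $(I-J)P\neq 0$. (ii) There exists an idempotent $Q'\in\mathcal{B}(\mathcal{H})^{Id}\setminus\mathcal{P}(\mathcal{H})$ such that $Q'_{or}=P$ and $JQ'=Q'^{*}J$ if and only if $\dim R(I-P)\geq 2$ and both $(I+J)(I-P)\neq 0$ and $(I-J)(I-P)\neq 0$.
   Context: $\mathcal{H}$ is a separable complex Hilbert space; $\mathcal{B}(\mathcal{H})$ is the set of bounded linear operators on $\mathcal{H}$, $\mathcal{B}(\mathcal{H})^{Id}$ the set of all idempotents in it, and $\mathcal{P}(\mathcal{H})$ the set of all orthogonal projections. A symmetry is an operator $J\in\mathcal{B}(\mathcal{H})$ with $J=J^{*}=J^{-1}$. $R(T)$ denotes the range of $T$. For idempotents $P,Q$ write $P\preceq Q$ if $PQ=QP=P$; this is a partial order on $\mathcal{B}(\mathcal{H})^{Id}$. For $Q\in\mathcal{B}(\mathcal{H})^{Id}$, $Q_{or}:=\max_{\preceq}\{E: E\preceq Q,\ E\in\mathcal{P}(\mathcal{H})\}$ and $Q^{or}:=\min_{\preceq}\{E: Q\preceq E,\ E\in\mathcal{P}(\mathcal{H})\}$; both exist for every idempotent $Q$. *)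

(* Defs.v *)
From mathcomp Require Import all_boot all_order all_algebra.
From mathcomp Require Import all_classical all_reals all_analysis.
From mathcomp.real_closed Require Import complex.

Set Implicit Arguments.
Unset Strict Implicit.
Unset Printing Implicit Defensive.

Import Order.TTheory GRing.Theory Num.Theory.
Import numFieldNormedType.Exports.

Local Open Scope classical_set_scope.
Local Open Scope ring_scope.
Local Open Scope complex_scope.

Definition separable_space (T : topologicalType) : Prop :=
  exists2 D : set T, countable D & dense D.

Definition is_min (T : Type) (le : T -> T -> Prop) (S : set T) (m : T) : Prop :=
  S m /\ forall x, S x -> le m x.

Definition is_max (T : Type) (le : T -> T -> Prop) (S : set T) (m : T) : Prop :=
  S m /\ forall x, S x -> le x m.

Section Hilbert.
Context {R : realType} {H : completeNormedModType R[i]}.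

(* [dot] is linear in its first argument and conjugate-linear in the second.
   A complete normed module whose norm comes from such a form is a Hilbert
   space. *)
Definition norm_from (dot : {dot H for Num.conj}) : Prop :=
  forall x : H, dot x x = `|x| ^+ 2.

Definition lin_indep (n : nat) (v : 'I_n -> H) : Prop :=
  forall c : 'I_n -> R[i], \sum_(i < n) c i *: v i = 0 -> forall i, c i = 0.

(* [dim V >= n] for a subspace [V], possibly of infinite dimension. *)
Definition dim_ge (n : nat) (V : set H) : Prop :=
  exists2 v : 'I_n -> H, (forall i, V (v i)) & lin_indep v.

Definition bounded_ops : set (H -> H) :=
  [set T | linear T /\ exists M : R, forall x, `|T x| <= M%:C * `|x|].

Definition idempotents : set (H -> H) :=
  [set Q | bounded_ops Q /\ Q \o Q = Q].

Definition idem_le (P Q : H -> H) : Prop := P \o Q = P /\ Q \o P = P.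

Variable dot : {dot H for Num.conj}.

(* When [norm_from dot] holds, a bounded operator has exactly one adjoint
   (Riesz), so the default value [\0] is not used. *)
Definition adjoint (T : H -> H) : H -> H :=
  xget \0 [set S | bounded_ops S /\ forall x y, dot (T x) y = dot x (S y)].

Definition projections : set (H -> H) :=
  [set P | idempotents P /\ adjoint P = P].

Definition symmetries : set (H -> H) :=
  [set J | [/\ bounded_ops J, adjoint J = J & J \o J = idfun]].

(* [lower_or Q] and [upper_or Q] are $Q_{or}$ and $Q^{or}$. For an idempotent
   [Q] the maximum and the minimum exist and are unique, so the default value
   [Q] is not used. *)
Definition lower_or (Q : H -> H) : H -> H :=
  xget Q (is_max idem_le [set E | idem_le E Q /\ projections E]).

Definition upper_or (Q : H -> H) : H -> H :=
  xget Q (is_min idem_le [set E | idem_le Q E /\ projections E]).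

End Hilbert.

(* Main.v *)
From HB Require Import structures.
Require Import Defs.
From mathcomp Require Import all_boot all_order all_algebra.
From mathcomp Require Import all_classical all_reals all_analysis.
From mathcomp.real_closed Require Import complex.

(* The conditions of (i) say that both eigenspaces of J in R(P) are nonzero,
   which already forces dim R(P) >= 2.
   If J were 1 or -1 on R(P), then JQ = Q*J and Q <= P would make Q self-adjoint.
   Conversely, combining eigenvectors for 1 and -1 gives v in R(P) with
   c = <v, Jv> nonzero and c^2 <> <v, v>^2, and Q x = P x - (<x, Jv> / c) v works.
   Part (ii) is part (i) for I - P and I - Q'. *)

Set Implicit Arguments.
Unset Strict Implicit.
Unset Printing Implicit Defensive.

Import Order.TTheory GRing.Theory Num.Theory.
Import numFieldNormedType.Exports.

Local Open Scope classical_set_scope.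
Local Open Scope ring_scope.
Local Open Scope complex_scope.

(** * Inner product algebra, Cauchy-Schwarz, and the choice of a good vector *)

Section DotProduct.
(* [complex_scope] rebinds [_ ^*] to the conjugation of [R[i]]. *)
Local Open Scope ring_scope.
Context {C : numClosedFieldType} {U : lmodType C}.
Context (dot : {dot U for Num.conj}).
Implicit Types (x y u v e f : U) (a : C).

Lemma dotC x y : dot x y = (dot y x)^*.
Proof. by rewrite hermC expr0 mul1r. Qed.

Lemma dotZl a x y : dot (a *: x) y = a * dot x y.
Proof. exact: linearZl_LR. Qed.

Lemma dotZr a x y : dot x (a *: y) = a^* * dot x y.
Proof. exact: linearZr_LR. Qed.

Lemma dotDl x y u : dot (x + y) u = dot x u + dot y u.
Proof. exact: linearDl. Qed.

Lemma dotDr x y u : dot u (x + y) = dot u x + dot u y.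
Proof. exact: linearDr. Qed.

Lemma dotNr x u : dot u (- x) = - dot u x.
Proof. exact: linearNr. Qed.

Lemma dotBl x y u : dot (x - y) u = dot x u - dot y u.
Proof. exact: linearBl. Qed.

Lemma dotBr x y u : dot u (x - y) = dot u x - dot u y.
Proof. exact: linearBr. Qed.

Lemma dot_injr u v : (forall x, dot x u = dot x v) -> u = v.
Proof.
by move=> uv; apply/eqP; rewrite -subr_eq0 -(dnorm_eq0 dot) dotBr uv subrr.
Qed.

Lemma cauchy_schwarz x y : `|dot x y| ^+ 2 <= dot x x * dot y y.
Proof.
have [->|y0] := eqVneq y 0; first by rewrite !linear0r normr0 expr0n.
have yy : 0 < dot y y by rewrite dnorm_gt0.
(* Expanded, this square is [dot y y] times the gap in the inequality. *)
have: 0 <= dot (dot y y *: x - dot x y *: y) (dot y y *: x - dot x y *: y).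
  exact: dnorm_ge0.
rewrite dnormB /= !dnormZ ger0_norm ?(ltW yy) // dotZl dotZr.
have -> : dot y y * ((dot x y)^* * dot x y) = `|dot x y| ^+ 2 * dot y y.
  by rewrite normCKC mulrC.
have rD : (`|dot x y| ^+ 2 * dot y y)^* = `|dot x y| ^+ 2 * dot y y.
  by rewrite conj_Creal // rpredM ?rpredX ?normr_real ?gtr0_real.
rewrite rD opprD addrACA subrr addr0 subr_ge0.
by rewrite [dot y y ^+ 2]expr2 [leRHS]mulrC mulrA ler_pM2r.
Qed.

(* For [e], [f] in the two eigenspaces of [J], one of [e + f], [e + 2 f] works. *)
Lemma nondegenerate_vector (J : {linear U -> U}) e f :
  (forall x y, dot (J x) y = dot x (J y)) ->
  J e = e -> J f = - f -> e != 0 -> f != 0 ->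
  exists t : C, let v := e + t *: f in
    dot v (J v) != 0 /\ dot v (J v) ^+ 2 != dot v v ^+ 2.
Proof.
move=> sJ Je Jf e0 f0.
(* Self-adjointness of [J] gives <e, f> = <Je, f> = <e, Jf> = -<e, f>. *)
have ef : dot e f = 0.
  by apply/eqP; rewrite -eqNr -dotNr -Jf -sJ Je.
have fe : dot f e = 0 by rewrite dotC ef conjC0.
have pe : 0 < dot e e by rewrite dnorm_gt0.
have pf : 0 < dot f f by rewrite dnorm_gt0.
have vv t : 0 < t -> let v := e + t *: f in
    dot v v = dot e e + t ^+ 2 * dot f f /\
    dot v (J v) = dot e e - t ^+ 2 * dot f f.
  move=> t0 /=.
  have -> : J (e + t *: f) = e - t *: f.
    by rewrite linearD linearZ /= Je Jf scalerN.
  rewrite dotBr !dotDl !dotDr !dotZl !dotZr ef fe conj_Creal ?gtr0_real //.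
  by rewrite !(mulr0, addr0, add0r) expr2 mulrA.
(* The value |e|^2 - t^2 |f|^2 vanishes at t = 1 only if |e| = |f|, and then t = 2 gives -3
   |f|^2. *)
have [t t0 ct] : exists2 t : C, 0 < t & dot e e - t ^+ 2 * dot f f != 0.
  have [c1|c1] := eqVneq (dot e e) (dot f f); last first.
    by exists 1; rewrite ?ltr01 // expr1n mul1r subr_eq0.
  exists 2; rewrite ?ltr0n // c1 -{1}[dot f f]mul1r -mulrBl.
  by rewrite mulf_neq0 ?(lt0r_neq0 pf) // -natrX subr_eq0 (eqr_nat _ 1).
exists t; have /= [-> ->] := vv t t0; split=> //.
have tf : 0 < t ^+ 2 * dot f f by rewrite mulr_gt0 ?exprn_gt0.
rewrite eqf_sqr negb_or lt_eqF; last first.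
  by rewrite ltrBlDr -addrA ltrDl addr_gt0.
by rewrite gt_eqF // ltrBrDr opprD subrK (lt_trans _ pe) ?oppr_lt0.
Qed.

End DotProduct.

(** * Bounded operators, idempotents and their complements *)

Section BoundedOperators.
Context {R : realType} {H : completeNormedModType R[i]}.
Implicit Types T S P Q E F : H -> H.

Lemma linear_add T : linear T -> {morph T : x y / x + y}.
Proof. by move=> lT x y; have := lT 1 x y; rewrite !scale1r. Qed.

Lemma linear_sub T : linear T -> {morph T : x y / x - y}.
Proof. exact: zmod_morphism_linear. Qed.

Lemma linear_scale T : linear T -> forall a x, T (a *: x) = a *: T x.
Proof. by move=> lT a x; rewrite (scalable_linear lT). Qed.

Lemma linear_comp T S : linear T -> linear S -> linear (T \o S).
Proof. by move=> lT lS a x y; rewrite /= lS lT. Qed.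

(** Norms take values in [R[i]], so a nonnegative bound taken there can be added and multiplied
    directly. *)
Lemma bounded_opsP T :
  bounded_ops T <->
  linear T /\ exists2 M : R[i], 0 <= M & forall x, `|T x| <= M * `|x|.
Proof.
split=> [[lT [M TM]]|[lT [M M0 TM]]]; split=> //.
  exists `|M%:C| => // x; apply: (le_trans (TM x)).
  apply: le_trans (real_ler_norm _) _; last by rewrite normrM normr_id.
  by rewrite rpredM ?normr_real ?complex_real.
by exists (complex.Re M) => x; rewrite RRe_real ?ger0_real.
Qed.

Lemma bounded_ops_sub T S :
  bounded_ops T -> bounded_ops S -> bounded_ops (T \- S).
Proof.
move=> /bounded_opsP[lT [M M0 TM]] /bounded_opsP[lS [N N0 SN]].
apply/bounded_opsP; split=> [a x y|].
  by rewrite /= lT lS scalerBr opprD addrACA.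
exists (M + N) => [|x]; first exact: addr_ge0.
by rewrite mulrDl (le_trans (ler_normB _ _)) ?lerD.
Qed.

Lemma bounded_ops_comp T S :
  bounded_ops T -> bounded_ops S -> bounded_ops (T \o S).
Proof.
move=> /bounded_opsP[lT [M M0 TM]] /bounded_opsP[lS [N N0 SN]].
apply/bounded_opsP; split; first exact: linear_comp.
exists (M * N) => [|x]; first exact: mulr_ge0.
by rewrite (le_trans (TM _)) // -mulrA ler_wpM2l.
Qed.

Lemma bounded_ops_id : bounded_ops (idfun : H -> H).
Proof.
by apply/bounded_opsP; split=> //; exists 1 => // x; rewrite mul1r.
Qed.

Lemma bounded_ops_compl T : bounded_ops T -> bounded_ops (idfun \- T).
Proof. exact/bounded_ops_sub/bounded_ops_id. Qed.

Lemma complK T : idfun \- (idfun \- T) = T.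
Proof. by apply/funext => x; rewrite /= subKr. Qed.

Lemma idempotents_compl Q : idempotents Q -> idempotents (idfun \- Q).
Proof.
move=> [bQ QQ]; split; first exact: bounded_ops_compl.
apply/funext => x /=; rewrite (linear_sub bQ.1).
by have /= -> := congr1 (@^~ x) QQ; rewrite subrr subr0.
Qed.

Lemma idem_leP P Q :
  idem_le P Q <-> (forall x, P (Q x) = P x) /\ (forall x, Q (P x) = P x).
Proof.
split=> [[PQ QP]|[PQ QP]]; last by split; apply/funext.
by split=> x; [exact: (congr1 (@^~ x) PQ)|exact: (congr1 (@^~ x) QP)].
Qed.

Lemma idem_le_compl P Q : linear P -> linear Q ->
  idem_le P Q -> idem_le (idfun \- Q) (idfun \- P).
Proof.
move=> lP lQ /idem_leP[PQ QP]; apply/idem_leP; split=> x /=.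
  by rewrite (linear_sub lQ) QP opprB addrA subrK.
by rewrite (linear_sub lP) PQ subrr subr0.
Qed.

Lemma idem_le_anti P Q : idem_le P Q -> idem_le Q P -> P = Q.
Proof. by move=> [PQ _] [_]; rewrite PQ. Qed.

End BoundedOperators.

(** * Adjoints, projections, symmetries and the extremal projections of an idempotent *)

Section Adjoint.
Context {R : realType} {H : completeNormedModType R[i]}.
Context (dot : {dot H for Num.conj}).
Implicit Types (T S P Q E J : H -> H) (x y u v : H).

Definition self_adjoint T : Prop := forall x y, dot (T x) y = dot x (T y).

Lemma adjointE T S : bounded_ops S ->
  (forall x y, dot (T x) y = dot x (S y)) -> adjoint dot T = S.
Proof.
move=> bS TS; apply: xget_unique => // S' [_ TS'].
by apply/funext => y; apply: (dot_injr (dot := dot)) => x; rewrite -TS' TS.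
Qed.

(* The default value [\0] of [adjoint] is itself self-adjoint, so Riesz's theorem
   is not needed here. *)
Lemma adjoint_id T : bounded_ops T -> adjoint dot T = T <-> self_adjoint T.
Proof.
move=> bT; split=> [|sT]; last exact: adjointE.
rewrite /adjoint; case: xgetP => [S _ [_ TS] ST|_ <- x y].
  by rewrite ST in TS.
by rewrite /= linear0l linear0r.
Qed.

Lemma projectionsP E : projections dot E <-> idempotents E /\ self_adjoint E.
Proof.
split=> [[iE aE]|[iE sE]]; split=> //; first exact/(adjoint_id iE.1).
exact/(adjoint_id iE.1).
Qed.

Lemma projections_compl E :
  projections dot E -> projections dot (idfun \- E).
Proof.
move=> /projectionsP[iE sE]; apply/projectionsP; split.
  exact: idempotents_compl.
by move=> x y; rewrite /= dotBl dotBr sE.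
Qed.

Lemma bounded_ops_rank1 (dotH : norm_from dot) u v :
  bounded_ops (fun x => dot x u *: v).
Proof.
apply/bounded_opsP; split=> [a x y|].
  by rewrite dotDl dotZl scalerDl scalerA.
exists (`|u| * `|v|) => [|x]; first by rewrite mulr_ge0.
rewrite normrZ mulrAC ler_wpM2r // mulrC -ler_sqr ?nnegrE ?mulr_ge0 //.
by rewrite exprMn -!dotH cauchy_schwarz.
Qed.

Lemma symmetriesP J : symmetries dot J ->
  [/\ bounded_ops J, self_adjoint J & forall x, J (J x) = x].
Proof.
move=> [bJ aJ JJ]; split=> //; first exact/(adjoint_id bJ).
by move=> x; exact: (congr1 (@^~ x) JJ).
Qed.

(** Since [J] is its own inverse, the relation says that the adjoint of [Q] is [J \o Q \o J]. *)
Lemma symmetry_twistP J Q : symmetries dot J -> bounded_ops Q ->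
  J \o Q = adjoint dot Q \o J <->
  (forall x y, dot (Q x) y = dot x (J (Q (J y)))).
Proof.
move=> /symmetriesP[bJ sJ JJ] bQ; split=> [|QJ].
  rewrite /adjoint; case: xgetP => [S _ [_ QS] JQ x y|_ JQ x y].
    by have /= -> := congr1 (@^~ (J y)) JQ; rewrite JJ.
  (* With the default adjoint [\0], [J \o Q] vanishes, hence so does [Q], and both sides are
     zero. *)
  have Q0 z : J (Q z) = 0 by exact: (congr1 (@^~ z) JQ).
  by rewrite Q0 linear0r -[Q x]JJ Q0 sJ linear0l.
rewrite (@adjointE _ (J \o Q \o J)) //.
  by apply/funext => x /=; rewrite JJ.
by do 2![apply: bounded_ops_comp => //].
Qed.

Lemma symmetry_twist_compl J Q : symmetries dot J -> bounded_ops Q ->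
  J \o Q = adjoint dot Q \o J ->
  J \o (idfun \- Q) = adjoint dot (idfun \- Q) \o J.
Proof.
move=> symJ bQ /(symmetry_twistP symJ bQ) QJ.
apply/(symmetry_twistP symJ); first exact: bounded_ops_compl.
have [bJ _ JJ] := symmetriesP symJ.
by move=> x y; rewrite /= (linear_sub bJ.1) JJ dotBl dotBr QJ.
Qed.

(** The default value of [upper_or] is [Q], which cannot equal [P] because only [P] is a projection;
    antisymmetry makes the minimum unique. *)
Lemma upper_orP P Q : projections dot P -> ~ projections dot Q ->
  upper_or dot Q = P <->
  is_min idem_le [set E | idem_le Q E /\ projections dot E] P.
Proof.
move=> pP nQ; split=> [|mP].
  by rewrite /upper_or; case: xgetP => [E _ mE <- //|_ QP]; rewrite QP in nQ.
by apply: xget_unique => // E mE; apply: idem_le_anti;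
  [exact/mE.2/mP.1|exact/mP.2/mE.1].
Qed.

Lemma lower_orP P Q : projections dot P -> ~ projections dot Q ->
  lower_or dot Q = P <->
  is_max idem_le [set E | idem_le E Q /\ projections dot E] P.
Proof.
move=> pP nQ; split=> [|mP].
  by rewrite /lower_or; case: xgetP => [E _ mE <- //|_ QP]; rewrite QP in nQ.
by apply: xget_unique => // E mE; apply: idem_le_anti;
  [exact/mP.2/mE.1|exact/mE.2/mP.1].
Qed.

(** Complementation is an order-reversing involution that preserves projections, so it swaps maxima
    and minima. *)
Lemma is_max_compl P Q : projections dot P -> bounded_ops Q ->
  is_max idem_le [set E | idem_le E Q /\ projections dot E] P <->
  is_min idem_le [set E | idem_le (idfun \- Q) E /\ projections dot E]
    (idfun \- P).
Proof.
have lp E : projections dot E -> linear E by case=> [[[]]].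
have lc T : linear T -> linear (idfun \- T).
  by move=> lT a x y; rewrite /= lT scalerBr opprD addrACA.
move=> pP [lQ _]; have lP := lp _ pP.
have cQ E : projections dot E -> idem_le (idfun \- Q) E ->
    idem_le (idfun \- E) Q.
  move=> pE /(idem_le_compl (lc _ lQ) (lp _ pE)); by rewrite complK.
split=> [[[PQ _] mP]|[[QP pP'] mP]]; split.
- split; [exact: idem_le_compl|exact: projections_compl].
- move=> E [QE pE]; have lE := lp _ pE.
  rewrite -[E]complK; apply: idem_le_compl => //; first exact: lc.
  by apply: mP; split; [exact: cQ|exact: projections_compl].
- by split=> //; rewrite -[P]complK; exact: cQ.
- move=> E [EQ pE]; have lE := lp _ pE.
  rewrite -[E]complK -[P]complK; apply: idem_le_compl; [exact: lc..|].
  apply: mP; split; [exact: idem_le_compl|exact: projections_compl].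
Qed.

(** As Q = PQP and [J] is the scalar s on R(P), JQJ = s^2 Q = Q; the twist relation identifies JQJ
    with the adjoint of [Q]. *)
Lemma twisted_self_adjoint (s : R[i]) P J Q : symmetries dot J ->
  bounded_ops Q -> idem_le Q P -> J \o P = P \o J ->
  s * s = 1 -> (forall x, J (P x) = s *: P x) ->
  J \o Q = adjoint dot Q \o J -> self_adjoint Q.
Proof.
move=> symJ bQ /idem_leP[QP PQ] JP ss JPs /(symmetry_twistP symJ bQ) QJ x y.
have [bJ _ JJ] := symmetriesP symJ.
rewrite QJ -[Q (J y)]QP.
have /= <- := congr1 (@^~ y) JP.
rewrite JPs (linear_scale bQ.1) QP (linear_scale bJ.1) -PQ JPs scalerA ss.
by rewrite scale1r.
Qed.

End Adjoint.

(** * Eigenvectors of [J] in R(P) and the construction of [Q] *)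

Section TwistedIdempotents.
Context {R : realType} {H : completeNormedModType R[i]}.
Context (dot : {dot H for Num.conj}) (dotH : norm_from dot).
Context (P J : H -> H) (projP : projections dot P) (symJ : symmetries dot J).
Context (JP : J \o P = P \o J).

(** Writing the sign as a scalar, here and in [comp_subN0], lets the lemmas with a parameter [s]
    treat both eigenvalues at once. *)
Lemma comp_addN0 : ((idfun \+ J) \o P <> \0) <->
  ~ (forall x, J (P x) = -1 *: P x).
Proof.
split; apply: contra_not => h; first apply/funext; move=> x.
  by rewrite /= h scaleN1r subrr.
by apply/eqP; rewrite scaleN1r -addr_eq0 addrC; apply/eqP/(congr1 (@^~ x) h).
Qed.

Lemma comp_subN0 : ((idfun \- J) \o P <> \0) <->
  ~ (forall x, J (P x) = 1 *: P x).
Proof.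
split; apply: contra_not => h; first apply/funext; move=> x.
  by rewrite /= h scale1r subrr.
apply/esym/eqP; rewrite scale1r -subr_eq0.
by apply/eqP/(congr1 (@^~ x) h).
Qed.

Lemma commute_sym_proj x : P (J x) = J (P x).
Proof. by rewrite -[RHS]/((J \o P) x) JP. Qed.

Lemma eigenvector_in_range (s : R[i]) : s * s = 1 ->
  ~ (forall x, J (P x) = - s *: P x) ->
  exists2 e, e != 0 & P e = e /\ J e = s *: e.
Proof.
move=> ss /existsNP[x Jx].
have [[[bP PP] _] [bJ _ JJ]] := (projP, symmetriesP symJ).
have {}PP y : P (P y) = P y by exact: (congr1 (@^~ y) PP).
(* Up to a factor 2 this is the projection of [P x] onto the s-eigenspace of [J]; it vanishes only
   if J(Px) = -s Px. *)
exists (P x + s *: J (P x)); last first.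
  rewrite (linear_add bP.1) (linear_add bJ.1) (linear_scale bP.1).
  rewrite (linear_scale bJ.1) JJ commute_sym_proj PP.
  by split=> //; rewrite scalerDr scalerA ss scale1r addrC.
apply: contra_notN Jx => /eqP e0.
rewrite -[LHS]scale1r -ss -scalerA scaleNr -scalerN; congr (_ *: _).
by apply/eqP; rewrite -addr_eq0 addrC e0.
Qed.

Lemma dim_ge2_range e f : P e = e -> P f = f -> J e = e -> J f = - f ->
  e != 0 -> f != 0 -> dim_ge 2 (range P).
Proof.
move=> Pe Pf Je Jf e0 f0; have [bJ _ _] := symmetriesP symJ.
exists (fun i : 'I_2 => if i == 0 then e else f) => [i|c].
  by case: ifP => _; [exists e|exists f].
rewrite big_ord_recl big_ord1 /=; set a := c _; set b := c _ => ab.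
(* Applying [J] to the relation flips the sign of the [f] term; adding the two relations leaves 2a e
   = 0. *)
have ab' : a *: e - b *: f = 0.
  have : J (a *: e + b *: f) = J 0 by rewrite ab.
  rewrite (linear_add bJ.1) !(linear_scale bJ.1) Je Jf scalerN => ->.
  by rewrite -(subrr 0) (linear_sub bJ.1) !subrr.
have dbl (d : R[i]) (g : H) : g != 0 -> d *: g + d *: g = 0 -> d = 0.
  move=> g0 /eqP; rewrite -scalerDl scaler_eq0 (negPf g0) orbF -mulr2n.
  by rewrite mulrn_eq0 /= => /eqP.
have a0 : a = 0.
  by apply: (dbl _ _ e0); rewrite -[RHS]addr0 -{1}ab -ab' addrACA subrr addr0.
have b0 : b = 0.
  by apply/eqP; move/eqP: ab; rewrite a0 scale0r add0r scaler_eq0 (negPf f0) orbF.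
by move=> i; case: (unliftP 0 i) => [j ->|->]; rewrite ?ord1.
Qed.

(* With [c = <v, J v>] real, [x |-> <x, J v> / c *: v] is a [J]-self-adjoint
   rank-one idempotent below [P]; [Q] is what remains of [P]. A projection
   above [Q] fixes [Q (J v)] and [Q* v], hence [v] and [J v] because
   [c^2 != <v, v>^2]. *)
Lemma twisted_idempotent v : P v = v -> dot v (J v) != 0 ->
  dot v (J v) ^+ 2 != dot v v ^+ 2 ->
  exists Q, [/\ (idempotents `\` projections dot) Q,
    upper_or dot Q = P & J \o Q = adjoint dot Q \o J].
Proof.
move=> Pv; set c := dot v (J v); set d := dot v v => c0 cd.
have [/projectionsP[[bP PP] sP] [bJ sJ JJ]] := (projP, symmetriesP symJ).
have {}PP y : P (P y) = P y by exact: (congr1 (@^~ y) PP).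
have PJv : P (J v) = J v by rewrite commute_sym_proj Pv.
have JvJv : dot (J v) (J v) = d by rewrite sJ JJ.
have cC : Num.conj c = c by rewrite -dotC sJ.
have dC : Num.conj d = d by rewrite -dotC.
pose N x := dot x (J v) *: (c^-1 *: v).
pose Q := P \- N.
have bN : bounded_ops N by exact: bounded_ops_rank1.
have bQ : bounded_ops Q by exact: bounded_ops_sub.
have NE x : N x = (dot x (J v) / c) *: v by rewrite /N scalerA.
have Nv : N v = v by rewrite NE divff // scale1r.
have PN x : P (N x) = N x by rewrite NE (linear_scale bP.1) Pv.
have NP x : N (P x) = N x by rewrite !NE sP PJv.
have NN x : N (N x) = N x by rewrite (NE x) (linear_scale bN.1) Nv.
have QP x : Q (P x) = Q x by rewrite /Q /= PP NP.
have PQ x : P (Q x) = Q x by rewrite /Q /= (linear_sub bP.1) PP PN.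
have iQ : idempotents Q.
  split=> //; apply/funext => x /=.
  by rewrite {1}/Q /= PQ /Q /= (linear_sub bN.1) NP NN subrr subr0.
have Qv : Q v = 0 by rewrite /Q /= Pv Nv subrr.
have QJv : Q (J v) = J v - (d / c) *: v by rewrite /Q /= PJv NE JvJv.
(* [P] commutes with [J], and as [c] is real the adjoint of [N] is y |-> (<y, v> / c) J v, which is
   JNJ. *)
have QJ x y : dot (Q x) y = dot x (J (Q (J y))).
  rewrite /Q /= dotBl (linear_sub bJ.1) dotBr commute_sym_proj JJ sP.
  rewrite !NE (linear_scale bJ.1) dotZl dotZr rmorphM fmorphV /= cC -dotC sJ JJ.
  by congr (_ - _); rewrite mulrAC [RHS]mulrAC [dot x (J v) * _]mulrC.
(* Self-adjointness would give <Q(Jv), v> = <Jv, Qv> = 0, but the left side is c - d^2 / c. *)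
have nQ : ~ projections dot Q.
  move=> /projectionsP[_ /(_ (J v) v)]; rewrite Qv linear0r QJv dotBl dotZl.
  rewrite sJ => /eqP; rewrite -/c subr_eq0 => /eqP cdd.
  by move/eqP: cd; apply; rewrite !expr2 {1}cdd mulrAC mulfVK.
exists Q; split=> //; last exact/(symmetry_twistP symJ bQ).
apply/(upper_orP projP nQ); split=> [|E].
  by split=> //; apply/idem_leP; split.
move=> [/idem_leP[QE EQ] /projectionsP[[bE _] sE]].
(* Taking adjoints in QE = Q shows that [E] fixes the range of the adjoint JQJ. *)
have ES x : E (J (Q (J x))) = J (Q (J x)).
  by apply: (dot_injr (dot := dot)) => y; rewrite -sE -!QJ QE.
(* [E] fixes Q(Jv) = Jv - (d/c) v and JQJ v = v - (d/c) Jv. This linear system for Ev and E(Jv) has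
   determinant 1 - (d/c)^2, which is nonzero. *)
have E1 : E (J v) = J v - (d / c) *: v + (d / c) *: E v.
  have := EQ (J v); rewrite QJv (linear_sub bE.1) (linear_scale bE.1) => <-.
  by rewrite subrK.
have E2 : E v = v - (d / c) *: J v + (d / c) *: E (J v).
  have := ES v; rewrite QJv (linear_sub bJ.1) JJ (linear_scale bJ.1).
  by rewrite (linear_sub bE.1) (linear_scale bE.1) => <-; rewrite subrK.
have Ev : E v = v.
  have s1 : 1 - (d / c) ^+ 2 != 0.
    rewrite subr_eq0 eq_sym exprMn exprVn; apply: contraNneq cd => cd1.
    by rewrite -[eqbRHS](mulfVK (expf_neq0 2 c0)) cd1 mul1r.
  apply/eqP; rewrite -subr_eq0; apply/eqP/(scalerI s1).
  have E3 : E v = v - (d / c) ^+ 2 *: v + (d / c) ^+ 2 *: E v.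
    rewrite {1}E2 E1 scalerDr scalerBr !scalerA -expr2.
    by rewrite !addrA subrK.
  rewrite scaler0 scalerBl scale1r scalerBr; apply/eqP.
  by rewrite subr_eq0 subr_eq {1}E3 addrC -[eqbRHS]addrA [- _ + v]addrC.
have EJv : E (J v) = J v by rewrite E1 Ev subrK.
have EN x : E (N x) = N x by rewrite NE (linear_scale bE.1) Ev.
have NE' x : N (E x) = N x by rewrite !NE sE EJv.
(* [E] absorbs both [Q] and [N] from either side, hence also their sum [P]. *)
have PE x : P x = Q x + N x by rewrite /Q /= subrK.
apply/idem_leP; split=> x; first by rewrite !PE QE NE'.
by rewrite PE (linear_add bE.1) EQ EN.
Qed.

Lemma upper_twistedP :
  (exists Q, [/\ (idempotents `\` projections dot) Q,
     upper_or dot Q = P & J \o Q = adjoint dot Q \o J]) <->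
  [/\ dim_ge 2 (range P), (idfun \+ J) \o P <> \0 & (idfun \- J) \o P <> \0].
Proof.
have eigen : (idfun \+ J) \o P <> \0 -> (idfun \- J) \o P <> \0 ->
    exists e f, [/\ e != 0, f != 0, P e = e, P f = f & J e = e /\ J f = - f].
  move=> /comp_addN0 p /comp_subN0 m.
  have [e e0 [Pe Je]] := eigenvector_in_range (mulr1 1) p.
  have [||f f0 [Pf Jf]] := @eigenvector_in_range (-1).
  - by rewrite mulrNN mulr1.
  - by rewrite opprK.
  by exists e, f; split=> //; rewrite Je Jf scale1r scaleN1r.
split=> [[Q [[iQ nQ] /(upper_orP projP nQ)[[QP _] _] JQ]]|[_ p m]].
  (* If [J] were the scalar s on R(P), [Q] would be a projection; s = -1 and s = 1 give the two
     conditions. *)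
  have key s : s * s = 1 -> ~ (forall x, J (P x) = s *: P x).
    move=> ss Js; apply: nQ; apply/projectionsP; split=> //.
    exact: (twisted_self_adjoint symJ iQ.1 QP JP ss Js JQ).
  have p : (idfun \+ J) \o P <> \0.
    by apply/comp_addN0/key; rewrite mulrNN mulr1.
  have m : (idfun \- J) \o P <> \0 by apply/comp_subN0/key; rewrite mulr1.
  split=> //; have [e [f [e0 f0 Pe Pf [Je Jf]]]] := eigen p m.
  exact: (dim_ge2_range Pe Pf Je Jf e0 f0).
have [e [f [e0 f0 Pe Pf [Je Jf]]]] := eigen p m.
have [bJ sJ _] := symmetriesP symJ.
pose J' : {linear H -> H} := HB.pack J (GRing.isLinear.Build _ _ _ _ J bJ.1).
have [t /= [c0 cd]] := @nondegenerate_vector _ _ dot J' e f sJ Je Jf e0 f0.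
apply: (twisted_idempotent _ c0 cd).
have bP : bounded_ops P by case: projP => [[]].
by rewrite (linear_add bP.1) (linear_scale bP.1) Pe Pf.
Qed.

End TwistedIdempotents.

(** * Both equivalences, the second by passing to complements *)

Theorem theorem3p8 (R : realType) (H : completeNormedModType R[i])
    (dot : {dot H for Num.conj}) (dotH : norm_from dot)
    (sepH : separable_space H) (P J : H -> H) (projP : projections dot P)
    (symJ : symmetries dot J) (JP : J \o P = P \o J) :
  ((exists Q : H -> H,
      [/\ (idempotents `\` projections dot) Q,
          upper_or dot Q = P & J \o Q = adjoint dot Q \o J])
   <-> [/\ dim_ge 2 (range P),
           (idfun \+ J) \o P <> \0 & (idfun \- J) \o P <> \0])
  /\
  ((exists Q' : H -> H,
      [/\ (idempotents `\` projections dot) Q',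
          lower_or dot Q' = P & J \o Q' = adjoint dot Q' \o J])
   <-> [/\ dim_ge 2 (range (idfun \- P)),
           (idfun \+ J) \o (idfun \- P) <> \0
         & (idfun \- J) \o (idfun \- P) <> \0]).
Proof.
split; first exact: upper_twistedP.
have lP : linear P by case: projP => [[[]]].
have lJ : linear J by case: symJ => [[]].
have JP' : J \o (idfun \- P) = (idfun \- P) \o J.
  apply/funext => x; rewrite /= (linear_sub lJ).
  by have /= -> := congr1 (@^~ x) JP.
have projP' := projections_compl projP.
apply: iff_trans (upper_twistedP dotH projP' symJ JP').
have compl Q : (idempotents `\` projections dot) Q ->
    (idempotents `\` projections dot) (idfun \- Q).
  move=> [iQ nQ]; split; first exact: idempotents_compl.
  by move=> /projections_compl; rewrite complK.
split=> -[Q [iQ orQ JQ]]; exists (idfun \- Q); split.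
- exact: compl.
- apply/(upper_orP projP' (compl _ iQ).2)/(is_max_compl projP iQ.1.1).
  exact/(lower_orP projP iQ.2).
- exact: (symmetry_twist_compl symJ iQ.1.1).
- exact: compl.
- apply/(lower_orP projP (compl _ iQ).2).
  apply/(is_max_compl projP (compl _ iQ).1.1).
  rewrite complK; exact/(upper_orP projP' iQ.2).
- exact: (symmetry_twist_compl symJ iQ.1.1).
Qed.
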